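(* For every integer $n\ge 0$, the functor $I^{\otimes 2}\otimes\Lambda^n$ is an artinian object of the category $\mathcal{F}$.
   Context: $\mathcal{E}$ is the category of $\mathbb{F}_2$-vector spaces, $\mathcal{E}^f$ its full subcategory of finite-dimensional spaces, and $\mathcal{F}$ is the (abelian) category of functors $\mathcal{E}^f\to\mathcal{E}$; limits, colimits and exactness are computed pointwise, and $\otimes$ on $\mathcal{F}$ is the pointwise tensor product over $\mathbb{F}_2$. $\Lambda^n$ is the $n$-th exterior power functor. $I$ is the functor $V\mapsto \mathbb{F}_2^{V^*}$ (all set-theoretic functions $V^*\to\mathbb{F}_2$, where $V^*$ is the dual of $V$), so that $I^{\otimes 2}(V)\simeq \mathbb{F}_2^{(V^* )^{\oplus 2}}$. An object is artinian if every decreasing sequence of subobjects stabilizes. *)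

(* Defs.v *)
From HB Require Import structures.
From mathcomp Require Import all_boot all_order all_algebra.
From mathcomp Require Import boolp classical_sets functions.
From mathcomp Require Import freeg.

Set Implicit Arguments.
Unset Strict Implicit.
Unset Printing Implicit Defensive.

Import GRing.Theory.
Local Open Scope ring_scope.
Local Open Scope quotient_scope.

Section QuotientModule.
Variables (R : nzRingType) (M : lmodType R).

Definition lspan (A : set M) : {pred M} := fun x =>
  `[< exists2 s : seq (R * M), (forall p, p \in s -> A p.2)
                             & x = \sum_(p <- s) p.1 *: p.2 >].

Lemma lspan_submod_closed (A : set M) : submod_closed (lspan A).
Proof.
split; first by apply/asboolP; exists [::]; rewrite ?big_nil.
move=> a x y /asboolP[s sA ->] /asboolP[t tA ->]; apply/asboolP.
exists ([seq (a * p.1, p.2) | p <- s] ++ t) => [p|].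
  rewrite mem_cat => /orP[/mapP[q qs ->]|/tA //]; exact: (sA q).
rewrite big_cat big_map /= scaler_sumr; congr (_ + _).
by apply: eq_bigr => p _; rewrite scalerA.
Qed.

HB.instance Definition _ (A : set M) :=
  GRing.isSubmodClosed.Build R M (lspan A) (lspan_submod_closed A).

Lemma sub_lspan (A : set M) x : A x -> x \in lspan A.
Proof.
move=> Ax; apply/asboolP; exists [:: (1, x)]; last by rewrite big_seq1 scale1r.
by move=> p; rewrite inE => /eqP->.
Qed.

Definition lquot (A : set M) : Type := Quotient.quot (lspan A).

Variable A : set M.

HB.instance Definition _ := GRing.Zmodule.on (lquot A).
HB.instance Definition _ := EqQuotient.on (lquot A).

Definition lquot_proj (x : M) : lquot A := \pi_(Quotient.quot (lspan A)) x.

Lemma lquot_proj_eq x y : (lquot_proj x = lquot_proj y) <-> (x - y \in lspan A).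
Proof. by rewrite Quotient.idealrBE; split=> [/eqP|/eqP]. Qed.

Lemma lquot_projB : zmod_morphism lquot_proj.
Proof. by move=> x y; rewrite /lquot_proj !piE. Qed.

Lemma lquot_proj_surj (x : lquot A) : exists y, x = lquot_proj y.
Proof. by exists (repr x); rewrite /lquot_proj reprK. Qed.

Definition lquot_scale (a : R) (x : lquot A) : lquot A :=
  lquot_proj (a *: repr x).

Lemma lquot_scaleE a x : lquot_scale a (lquot_proj x) = lquot_proj (a *: x).
Proof.
apply/lquot_proj_eq; rewrite -scalerBr rpredZ //.
by apply/lquot_proj_eq; rewrite /lquot_proj reprK.
Qed.

Lemma lquot_projD x y : lquot_proj (x + y) = lquot_proj x + lquot_proj y.
Proof. by rewrite /lquot_proj !piE. Qed.

Lemma lquot_scaleA a b x : lquot_scale a (lquot_scale b x) = lquot_scale (a * b) x.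
Proof.
by have [y ->] := lquot_proj_surj x; rewrite !lquot_scaleE scalerA.
Qed.
Lemma lquot_scale1 : left_id 1 lquot_scale.
Proof.
by move=> x; have [y ->] := lquot_proj_surj x; rewrite lquot_scaleE scale1r.
Qed.
Lemma lquot_scaleDr : right_distributive lquot_scale +%R.
Proof.
move=> a x y; have [u ->] := lquot_proj_surj x; have [v ->] := lquot_proj_surj y.
by rewrite -lquot_projD !lquot_scaleE -lquot_projD scalerDr.
Qed.
Lemma lquot_scaleDl x : {morph lquot_scale^~ x : a b / a + b}.
Proof.
move=> a b; have [u ->] := lquot_proj_surj x.
by rewrite !lquot_scaleE -lquot_projD scalerDl.
Qed.

HB.instance Definition _ := GRing.Zmodule_isLmodule.Build R (lquot A)
  lquot_scaleA lquot_scale1 lquot_scaleDr lquot_scaleDl.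

Lemma lquot_proj_scalable : scalable lquot_proj.
Proof. by move=> a x; rewrite -lquot_scaleE. Qed.

HB.instance Definition _ :=
  GRing.isZmodMorphism.Build M (lquot A) lquot_proj lquot_projB.
HB.instance Definition _ :=
  GRing.isScalable.Build R M (lquot A) *:%R lquot_proj lquot_proj_scalable.

Section Lift.
Variables (N : lmodType R) (f : {linear M -> N}).
Hypothesis fA : forall x, A x -> f x = 0.

Definition lquot_lift of (forall x, A x -> f x = 0) : lquot A -> N :=
  fun x => f (repr x).

Lemma lquot_liftE x : lquot_lift fA (lquot_proj x) = f x.
Proof.
apply/eqP; rewrite /lquot_lift -subr_eq0 -linearB; apply/eqP.
have /asboolP[s sA ->] : repr (lquot_proj x) - x \in lspan A.
  by apply/lquot_proj_eq; rewrite /lquot_proj reprK.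
rewrite linear_sum big_seq big1 // => p ps.
rewrite linearZ_LR /= fA ?scaler0 //; exact: sA.
Qed.

Lemma lquot_lift_linear : linear (lquot_lift fA).
Proof.
move=> a x y; have [u ->] := lquot_proj_surj x; have [v ->] := lquot_proj_surj y.
by rewrite -linearP !lquot_liftE linearP.
Qed.

HB.instance Definition _ :=
  GRing.isLinear.Build R (lquot A) N *:%R (lquot_lift fA) lquot_lift_linear.
End Lift.

End QuotientModule.

Section FreeModule.
Variables (R : nzRingType) (X : choiceType).

Definition fgen (x : X) : {freeg X / R} := [freeg [:: (1, x)]].

Variables (N : lmodType R) (f : X -> N).

Lemma fglift_gen x : fglift f (fgen x) = f x.
Proof. by rewrite /fgen liftU scale1r. Qed.

Lemma freeg_gen_sum (D : {freeg X / R}) :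
  D = \sum_(z <- dom D) coeff z D *: fgen z.
Proof.
rewrite -[LHS]freeg_sumE; apply: eq_bigr => z _; apply/eqP/freeg_eqP => y.
by rewrite coeffZ !coeffU mul1r.
Qed.

Lemma fglift_linear : linear (fglift f).
Proof.
have B := lift_is_additive f.
have f0 : fglift f 0 = 0 by rewrite -[X in fglift _ X](subrr 0) B subrr.
have fN x : fglift f (- x) = - fglift f x by rewrite -sub0r B f0 sub0r.
have fD x y : fglift f (x + y) = fglift f x + fglift f y.
  by rewrite -{1}[y]opprK B fN opprK.
move=> a x y; rewrite fD; congr (_ + _).
have fS (s : seq X) (F : X -> {freeg X / R}) :
    fglift f (\sum_(z <- s) F z) = \sum_(z <- s) fglift f (F z).
  exact: (big_morph _ fD f0).
have fU c z : fglift f (c *: fgen z) = c *: f z.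
  suff -> : c *: fgen z = [freeg [:: (c, z)]] by rewrite liftU.
  by apply/eqP/freeg_eqP => t; rewrite coeffZ !coeffU mul1r.
rewrite [x]freeg_gen_sum scaler_sumr !fS scaler_sumr; apply: eq_bigr => z _.
by rewrite scalerA !fU scalerA.
Qed.

HB.instance Definition _ := GRing.isLinear.Build R {freeg X / R} N *:%R
  (fglift f) fglift_linear.

End FreeModule.

(* Tensor and exterior powers below are modules given by generators and relations.
   qgen_ext and qlift give their universal property. *)
Section Presented.
Variables (R : nzRingType) (X : choiceType) (A : set {freeg X / R}).

Definition qgen (x : X) : lquot A := lquot_proj A (fgen R x).

Variable N : lmodType R.

Lemma qgen_ext (f g : {linear lquot A -> N}) :
  (forall x, f (qgen x) = g (qgen x)) -> f =1 g.
Proof.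
move=> fg x; have [y ->] := lquot_proj_surj x.
rewrite [y]freeg_gen_sum !linear_sum; apply: eq_bigr => z _.
by rewrite !linearZ /=; congr (_ *: _); apply: fg.
Qed.

Variable phi : X -> N.
Hypothesis phiA : forall r, A r -> fglift phi r = 0.

Definition qlift : {linear lquot A -> N} := lquot_lift phiA.

Lemma qliftE x : qlift (qgen x) = phi x.
Proof. by rewrite -(fglift_gen phi); apply: (lquot_liftE phiA). Qed.
End Presented.

Section Tensor.
Variable R : comNzRingType.

Section Def.
Variables U V : lmodType R.
Local Notation gen u v := (fgen R (u, v)).

Inductive tens_rel : set {freeg (U * V)%type / R} :=
| TensRelL a u u' v :
    tens_rel (gen (a *: u + u') v - (a *: gen u v + gen u' v))
| TensRelR a u v v' :
    tens_rel (gen u (a *: v + v') - (a *: gen u v + gen u v')).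

Definition tens : lmodType R := lquot tens_rel.

Definition pure (u : U) (v : V) : tens := qgen tens_rel (u, v).

Lemma pure_linl v : linear (pure^~ v).
Proof.
move=> a u u'; rewrite /pure /qgen -linearP /=.
by apply/lquot_proj_eq/sub_lspan; constructor.
Qed.
Lemma pure_linr u : linear (pure u).
Proof.
move=> a v v'; rewrite /pure /qgen -linearP /=.
by apply/lquot_proj_eq/sub_lspan; constructor.
Qed.

Lemma tens_ext (N : lmodType R) (f g : {linear tens -> N}) :
  (forall u v, f (pure u v) = g (pure u v)) -> f =1 g.
Proof. by move=> fg; apply: qgen_ext => -[u v]; apply: fg. Qed.

Section Lift.
Variables (N : lmodType R) (b : U -> V -> N).
Hypotheses (bl : forall v, linear (b^~ v)) (br : forall u, linear (b u)).

Lemma tens_lift_rel r : tens_rel r -> fglift (fun p => b p.1 p.2) r = 0.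
Proof.
case=> [a u u' v|a u v v']; rewrite linearB linearP /= !fglift_gen /=.
  by rewrite (bl v a u u') subrr.
by rewrite (br u a v v') subrr.
Qed.

Definition tens_lift : {linear tens -> N} := qlift tens_lift_rel.

Lemma tens_liftE u v : tens_lift (pure u v) = b u v.
Proof. exact: qliftE. Qed.
End Lift.
End Def.

Section Map.
Variables (U V U' V' : lmodType R) (f : {linear U -> U'}) (g : {linear V -> V'}).

Lemma tens_map_linl v : linear (fun u => pure (f u) (g v)).
Proof. by move=> a u u'; rewrite linearP pure_linl. Qed.
Lemma tens_map_linr u : linear (fun v => pure (f u) (g v)).
Proof. by move=> a v v'; rewrite linearP pure_linr. Qed.

Definition tens_map : {linear tens U V -> tens U' V'} :=
  tens_lift tens_map_linl tens_map_linr.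

Lemma tens_mapE u v : tens_map (pure u v) = pure (f u) (g v).
Proof. exact: tens_liftE. Qed.
End Map.
End Tensor.

(* The n-th exterior power: the universal target of alternating n-linear maps;
   a repeated argument is killed, which in characteristic 2 is stronger than
   antisymmetry. *)
Section Exterior.
Variables (R : comNzRingType) (n : nat).

Definition upd (V : Type) (v : {ffun 'I_n -> V}) (i : 'I_n) (x : V) :
  {ffun 'I_n -> V} := [ffun j => if j == i then x else v j].

Definition multilinear (V N : lmodType R) (m : {ffun 'I_n -> V} -> N) :=
  forall v i, linear (fun x => m (upd v i x)).

Definition alternating (V N : lmodType R) (m : {ffun 'I_n -> V} -> N) :=
  forall (v : {ffun 'I_n -> V}) i j, i != j -> v i = v j -> m v = 0.

Section Def.
Variable V : lmodType R.

Inductive ext_rel : set {freeg {ffun 'I_n -> V} / R} :=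
| ExtRelLin v i a x y :
    ext_rel (fgen R (upd v i (a *: x + y)) -
             (a *: fgen R (upd v i x) + fgen R (upd v i y)))
| ExtRelAlt (v : {ffun 'I_n -> V}) i j : i != j -> v i = v j -> ext_rel (fgen R v).

Definition ext : lmodType R := lquot ext_rel.

Definition wedge (v : {ffun 'I_n -> V}) : ext := qgen ext_rel v.

Lemma wedge_multilinear : multilinear wedge.
Proof.
move=> v i a x y; rewrite /wedge /qgen -linearP /=.
by apply/lquot_proj_eq/sub_lspan; constructor.
Qed.

Lemma wedge_alternating : alternating wedge.
Proof.
move=> v i j ij vij; rewrite /wedge /qgen -[RHS](linear0 (lquot_proj ext_rel)).
by apply/lquot_proj_eq; rewrite subr0; apply/sub_lspan/(ExtRelAlt ij vij).
Qed.

Lemma ext_ext (N : lmodType R) (f g : {linear ext -> N}) :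
  (forall v, f (wedge v) = g (wedge v)) -> f =1 g.
Proof. exact: qgen_ext. Qed.

Section Lift.
Variables (N : lmodType R) (m : {ffun 'I_n -> V} -> N).
Hypotheses (mlin : multilinear m) (malt : alternating m).

Lemma ext_lift_rel r : ext_rel r -> fglift m r = 0.
Proof.
case=> [v i a x y|v i j ij vij]; last by rewrite fglift_gen (malt ij vij).
by rewrite linearB linearP /= !fglift_gen (mlin v i a x y) subrr.
Qed.

Definition ext_lift : {linear ext -> N} := qlift ext_lift_rel.

Lemma ext_liftE v : ext_lift (wedge v) = m v.
Proof. exact: qliftE. Qed.
End Lift.
End Def.

Section Map.
Variables (V W : lmodType R) (f : {linear V -> W}).

Let fw (v : {ffun 'I_n -> V}) := wedge [ffun i => f (v i)].

Lemma upd_map v i x :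
  [ffun j => f (upd v i x j)] = upd [ffun j => f (v j)] i (f x).
Proof. by apply/ffunP => j; rewrite !ffunE; case: ifP. Qed.

Lemma ext_map_multilinear : multilinear fw.
Proof. by move=> v i a x y; rewrite /fw !upd_map linearP wedge_multilinear. Qed.
Lemma ext_map_alternating : alternating fw.
Proof.
by move=> v i j ij vij; apply: (wedge_alternating ij); rewrite !ffunE vij.
Qed.

Definition ext_map : {linear ext V -> ext W} :=
  ext_lift ext_map_multilinear ext_map_alternating.

Lemma ext_mapE v : ext_map (wedge v) = wedge [ffun i => f (v i)].
Proof. exact: ext_liftE. Qed.
End Map.
End Exterior.

(* The category of functors from finite-dimensional F_2-vector spaces (vectType)
   to all F_2-vector spaces (lmodType). *)
Record vfunctor := VFunctor {
  fobj :> vectType 'F_2 -> lmodType 'F_2;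
  fmap : forall V W : vectType 'F_2, 'Hom(V, W) -> {linear fobj V -> fobj W};
  fmap_id : forall V : vectType 'F_2, fmap (\1%VF : 'Hom(V, V)) =1 id;
  fmap_comp : forall (U V W : vectType 'F_2) (g : 'Hom(V, W)) (f : 'Hom(U, V)),
    fmap (g \o f)%VF =1 fmap g \o fmap f
}.

Record nattrans (F G : vfunctor) := NatTrans {
  ncomp :> forall V : vectType 'F_2, {linear F V -> G V};
  natural : forall (V W : vectType 'F_2) (f : 'Hom(V, W)) (x : F V),
    ncomp W (fmap F f x) = fmap G f (ncomp V x)
}.

(* Monomorphism in the categorical sense; equality of natural transformations
   is pointwise. *)
Definition mono (F G : vfunctor) (m : nattrans F G) : Prop :=
  forall (H : vfunctor) (a b : nattrans H F),
    (forall V x, m V (a V x) = m V (b V x)) -> forall V x, a V x = b V x.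

(* A subobject is represented by a monomorphism; two of them are the same
   subobject when each factors through the other. *)
Record subobject (F : vfunctor) := Subobject {
  sub_dom : vfunctor;
  sub_incl : nattrans sub_dom F;
  sub_mono : mono sub_incl
}.

Definition sub_le (F : vfunctor) (S T : subobject F) : Prop :=
  exists h : nattrans (sub_dom S) (sub_dom T),
    forall V x, sub_incl T V (h V x) = sub_incl S V x.

Definition sub_eq (F : vfunctor) (S T : subobject F) : Prop :=
  sub_le S T /\ sub_le T S.

Definition artinian (F : vfunctor) : Prop :=
  forall S : nat -> subobject F,
    (forall k, sub_le (S k.+1) (S k)) ->
    exists N, forall k, (N <= k)%N -> sub_eq (S k) (S N).

Section TensorFunctor.
Variables F G : vfunctor.

Lemma tensF_id (V : vectType 'F_2) :
  tens_map (fmap F (\1%VF : 'Hom(V, V))) (fmap G (\1%VF : 'Hom(V, V))) =1 id.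
Proof.
apply: (tens_ext (g := idfun)) => u v.
by rewrite tens_mapE !fmap_id.
Qed.

Lemma tensF_comp (U V W : vectType 'F_2) (g : 'Hom(V, W)) (f : 'Hom(U, V)) :
  tens_map (fmap F (g \o f)%VF) (fmap G (g \o f)%VF) =1
  tens_map (fmap F g) (fmap G g) \o tens_map (fmap F f) (fmap G f).
Proof.
apply: (tens_ext (g := tens_map (fmap F g) (fmap G g) \o
                       tens_map (fmap F f) (fmap G f))) => u v.
rewrite tens_mapE !fmap_comp -[RHS]/(tens_map _ _ (tens_map _ _ (pure u v))).
by rewrite !tens_mapE.
Qed.

Definition tensF : vfunctor := VFunctor tensF_id tensF_comp.
End TensorFunctor.

Section ExteriorFunctor.
Variable n : nat.

Lemma extF_id (V : vectType 'F_2) : ext_map n (\1%VF : 'Hom(V, V)) =1 id.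
Proof.
apply: (ext_ext (g := idfun)) => v.
by rewrite ext_mapE; congr wedge; apply/ffunP => i; rewrite ffunE; exact: id_lfunE.
Qed.

Lemma extF_comp (U V W : vectType 'F_2) (g : 'Hom(V, W)) (f : 'Hom(U, V)) :
  ext_map n (g \o f)%VF =1 ext_map n g \o ext_map n f.
Proof.
apply: (ext_ext (g := ext_map n g \o ext_map n f)) => v.
rewrite -[RHS]/(ext_map n g (ext_map n f (wedge v))) !ext_mapE.
congr wedge; apply/ffunP => i.
by rewrite !ffunE; exact: comp_lfunE.
Qed.

Definition extF : vfunctor := VFunctor extF_id extF_comp.
End ExteriorFunctor.

Definition dual (V : vectType 'F_2) := 'Hom(V, ('F_2)^o).

Definition dual_fun (V : vectType 'F_2) : lmodType 'F_2 := dual V -> ('F_2)^o.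

Section DualFunctions.

(* Covariant: precomposition with the transpose of f. *)
Definition dual_fun_map (V W : vectType 'F_2) (f : 'Hom(V, W))
  (phi : dual_fun V) : dual_fun W := fun l : dual W => phi (l \o f)%VF.

Lemma dual_fun_map_linear (V W : vectType 'F_2) (f : 'Hom(V, W)) :
  linear (dual_fun_map f).
Proof. by []. Qed.

HB.instance Definition _ (V W : vectType 'F_2) (f : 'Hom(V, W)) :=
  GRing.isLinear.Build 'F_2 (dual_fun V) (dual_fun W) *:%R (dual_fun_map f)
    (dual_fun_map_linear f).

Lemma Ifun_id (V : vectType 'F_2) : dual_fun_map (\1%VF : 'Hom(V, V)) =1 id.
Proof. by move=> phi; apply/funext => l; rewrite /dual_fun_map comp_lfun1r. Qed.

Lemma Ifun_comp (U V W : vectType 'F_2) (g : 'Hom(V, W)) (f : 'Hom(U, V)) :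
  dual_fun_map (g \o f)%VF =1 dual_fun_map g \o dual_fun_map f.
Proof. by move=> phi; apply/funext => l; rewrite /dual_fun_map /= comp_lfunA. Qed.

Definition Ifun : vfunctor :=
  @VFunctor dual_fun (fun V W f => dual_fun_map f) Ifun_id Ifun_comp.
End DualFunctions.

(* Main.v *)
From HB Require Import structures.
From mathcomp Require Import all_boot all_algebra.
From mathcomp Require Import boolp classical_sets functions.
From mathcomp Require Import freeg.
From mathcomp Require Import zify.
Require Import Defs.

(** Write T for the tensor product of two copies of [Ifun] with the [n]-th
    exterior power.  The proof is a Groebner-basis argument on words.

    Restrict functors to the spaces of row vectors of length r, one for each r;
    every finite-dimensional space is isomorphic to one of them, so a subobject
    of T is determined by its restriction.  An elementary element
    phi (x) psi (x) (v_1 /\ ... /\ v_n) of T gives the function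
      (l, l', l_1, ..., l_n) |-> phi(l) psi(l') l_1(v_1) ... l_n(v_n)
    on (n + 2)-tuples of linear forms.  Reading off the values of these forms at
    each of the r basis vectors, such a tuple is a word of length r over the
    finite alphabet F_2 * F_2 * F_2^n, and a map g : 'I_r -> 'I_s of basis
    vectors acts on words by u |-> u o g.  This function is not
    determined by the element of T (it does not alternate in the v_i), but conversely a
    sum of elementary elements is determined by the sum of their functions
    ([word_fun_determines]): expand phi, psi and the v_i in coordinates.  Hence a
    subobject S of T is recovered from the spaces [lifts S r] of functions on
    words of length r that come from elements of S ([sub_le_lifts]), and it is
    enough that decreasing families of such spaces stabilize.

    That is [word_functions_artinian].  Order words of a given length
    lexicographically and call w a pivot of a space of functions if some member is
    non-zero at w and zero at all smaller words.  By elimination, nested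
    spaces with the same pivots are equal ([sub_of_pivots]).  If w' is obtained
    from w by inserting copies of letters that already occurred, then w' = w o g
    for a map g with u < w implying u o g < w o g; so when w' is a pivot, w is one
    too ([pivot_copies]).  This relation on words is a well-quasi-order, by
    Higman's lemma ([higman], [wqo_copies]), and in a strictly decreasing chain of
    pivot sets the removed words would form a bad sequence.

    Finally, subobjects are given by categorical monomorphisms, which are
    pointwise injective by the Yoneda lemma ([mono_injective]). *)

Set Implicit Arguments.
Unset Strict Implicit.
Unset Printing Implicit Defensive.

Import GRing.Theory passmx.

(** * Well-quasi-orders on words *)

(** Well-quasi-orders are stated through infinite ascending subsequences rather
    than good pairs: in this form a product of two of them is handled by extracting
    twice, with no appeal to Ramsey's theorem. *)
Definition wqo_on (X : Type) (D : set X) (R : X -> X -> Prop) : Prop :=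
  forall f : nat -> X, (forall i, D (f i)) ->
  exists2 h : nat -> nat, {homo h : i j / i < j}
                        & forall i j, i < j -> R (f (h i)) (f (h j)).

Lemma extract_subsequence (Q : nat -> Prop) :
  (forall n, exists2 i, n <= i & Q i) ->
  exists2 h : nat -> nat, {homo h : i j / i < j} & forall i, Q (h i).
Proof.
move=> Qinf.
have /choice[next nextP] n : exists i, n <= i /\ Q i by have [i] := Qinf n; exists i.
exists (fun i => iter i.+1 (next \o succn) 0) => [|i]; last first.
  by have [_] := nextP (iter i (next \o succn) 0).+1.
apply: homo_ltn => [j i k|i]; first exact: ltn_trans.
by have [] := nextP (iter i.+1 (next \o succn) 0).+1.
Qed.

Lemma infinite_pigeonhole (T : finType) (c : nat -> T) :
  exists a, exists2 h : nat -> nat, {homo h : i j / i < j} & forall i, c (h i) = a.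
Proof.
apply: contrapT => /forallNP nex.
have /choice[bound boundP] a : exists n, forall i, n <= i -> c i <> a.
  apply: contrapT => /forallNP unb; apply: (nex a).
  apply: (@extract_subsequence (fun i => c i = a)) => n.
  apply: contrapT => nQ; apply: (unb n) => i ni cia; apply: nQ; by exists i.
have := boundP (c (\max_a bound a)) (\max_a bound a); apply => //.
exact: leq_bigmax.
Qed.

Section Words.
Variable A : finType.
Implicit Types (p u v w : seq A) (a b : A).

(** Cut each word at its first letter satisfying [q].  Since the alphabet is finite,
    one may pass to a subsequence where this letter is constant (or always absent),
    then to one ascending in the prefixes, then to one ascending in the suffixes. *)
Lemma wqo_split (q : pred A) (D U : set (seq A)) (R : seq A -> seq A -> Prop)
    (Dt : A -> set (seq A)) (Rt : A -> seq A -> seq A -> Prop) :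
    wqo_on U subseq -> (forall a, q a -> wqo_on (Dt a) (Rt a)) ->
    (forall u, D u -> ~~ has q u -> U u) ->
    (forall u a v, D (u ++ a :: v) -> ~~ has q u -> q a -> U u /\ Dt a v) ->
    (forall u u', U u -> U u' -> subseq u u' -> R u u') ->
    (forall u u' a v v', U u -> U u' -> q a -> subseq u u' -> Rt a v v' ->
       R (u ++ a :: v) (u' ++ a :: v')) ->
  wqo_on D R.
Proof.
move=> Uwqo Dtwqo DU DUt RU RUt f Df.
have [[a|] [h hmono ch]] :=
    infinite_pigeonhole (fun i => onth (f i) (find q (f i))).
- pose g i := f (h i).
  pose u i := take (find q (g i)) (g i).
  pose v i := drop (find q (g i)).+1 (g i).
  have hasg i : has q (g i).
    by rewrite has_find -onthTE /g ch.
  have ga i : nth a (g i) (find q (g i)) = a.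
    exact: onth_nth (ch i).
  have guv i : g i = u i ++ a :: v i.
    by rewrite -[LHS](cat_take_drop (find q (g i))) (drop_nth a) -?has_find ?ga.
  have qa : q a by rewrite -(ga 0) nth_find.
  have qu i : ~~ has q (u i) by rewrite has_take ?ltnn // ltnW // -has_find.
  have uv i : U (u i) /\ Dt a (v i).
    by apply: DUt => //; rewrite -guv; apply: Df.
  have [h1 h1mono uh1] := Uwqo u (fun i => (uv i).1).
  have [h2 h2mono vh2] := Dtwqo a qa (v \o h1) (fun i => (uv (h1 i)).2).
  exists (h \o (h1 \o h2)) => [i j ij|i j ij]; first by apply/hmono/h1mono/h2mono.
  rewrite -/(g (h1 (h2 i))) -/(g (h1 (h2 j))) !guv.
  apply: RUt => //; by [case: (uv (h1 (h2 i))) | case: (uv (h1 (h2 j))) |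
                        apply/uh1/h2mono | apply: vh2].
- have qf i : ~~ has q (f (h i)).
    by rewrite has_find -onthTE ch.
  have Uf i : U (f (h i)) by apply: DU.
  have [h1 h1mono fh1] := Uwqo _ Uf.
  exists (h \o h1) => [i j ij|i j ij]; first exact/hmono/h1mono.
  by apply: RU; [apply: Uf | apply: Uf | apply: fh1].
Qed.

(** A word avoiding [a :: v] either has no [a], or is [u ++ a :: w] with no [a] in [u]
    and [w] avoiding [v]; so the alphabet or the avoided word gets smaller. *)
Lemma higman_avoid (C : {set A}) :
    (forall a, a \in C -> wqo_on [set w | all (mem (C :\ a)) w] subseq) ->
  forall v, all (mem C) v ->
  wqo_on [set w | all (mem C) w && ~~ subseq v w] subseq.
Proof.
move=> IHC; elim=> [_ f /(_ 0)|a v IHv]; first by rewrite /= sub0seq andbF.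
case/andP => aC vC.
have noa u : all (mem C) u -> ~~ has (pred1 a) u -> all (mem (C :\ a)) u.
  move=> /allP uC; rewrite has_pred1 => au; apply/allP => x xu.
  have /= xC := uC x xu.
  by rewrite /= !inE xC andbT; apply: contraNneq au => <-.
apply: (@wqo_split (pred1 a) _ [set w | all (mem (C :\ a)) w] _
  (fun=> [set w | all (mem C) w && ~~ subseq v w]%classic) (fun=> subseq)).
- exact: IHC.
- by move=> _ _; apply: IHv.
- by move=> u /andP[uC _] /(noa _ uC).
- move=> u b w /andP[]; rewrite all_cat => /andP[uC /andP[_ wC]] + ub /eqP eb.
  rewrite eb => nsub; split; first exact: noa.
  apply/andP; split; first exact: wC.
  apply: contra nsub => vw.
  by rewrite -[a :: v]cat0s cat_subseq ?sub0seq //= eqxx.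
- by [].
- by move=> u u' b w w' _ _ _ uu' ww'; rewrite cat_subseq //= eqxx.
Qed.

(** Higman's lemma for a finite alphabet.  Either some term of the sequence is avoided
    by infinitely many terms, and [higman_avoid] applies to these, or every term is a
    subsequence of all late enough ones, and a chain is built greedily. *)
Lemma higman (C : {set A}) : wqo_on [set w | all (mem C) w] subseq.
Proof.
have [m] := ubnP #|C|; elim: m C => // m IHm C; rewrite ltnS => Cm f fC.
have avoid v := @higman_avoid C _ v.
have {}avoid : forall v, all (mem C) v ->
    wqo_on [set w | all (mem C) w && ~~ subseq v w] subseq.
  move=> v; apply: avoid => a aC; apply: IHm.
  by apply: leq_trans Cm; rewrite (cardsD1 a C) aC.
have [[i Hi]|fin] := pselect (exists i, forall n,
    exists2 j, n <= j & ~~ subseq (f i) (f j)).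
  have [h hmono fh] := extract_subsequence Hi.
  have [|h1 h1mono fh1] := avoid (f i) (fC i) (f \o h).
    by move=> j /=; rewrite fh andbT; apply: fC.
  exists (h \o h1) => [k j kj|k j kj]; [exact/hmono/h1mono | exact: fh1].
have /choice[next nextP] i : exists n, i < n /\ subseq (f i) (f n).
  apply: contrapT => /forallNP none; apply: fin; exists i => n.
  exists (maxn n i.+1); first exact: leq_maxl.
  by apply/negP => fi; apply: (none (maxn n i.+1)); rewrite leq_maxr.
exists (fun i => iter i next 0) => [|i j].
  by apply: homo_ltn => [j i k|i]; [exact: ltn_trans | have [] := nextP (iter i next 0)].
apply: (homo_ltn (f := fun i => f (iter i next 0)) (r := subseq)) => [y x z|k].
  exact: subseq_trans.
by have [] := nextP (iter k next 0).
Qed.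

(** [copies p w w']: after the prefix [p] has been read, [w'] arises from [w] by inserting
    letters each of which occurs earlier.  For empty [p] this says that w' = w o g for a
    surjection g of positions whose fibres have increasing minima. *)
Inductive copies : seq A -> seq A -> seq A -> Prop :=
| CopiesNil p : copies p [::] [::]
| CopiesKeep p a w w' : copies (rcons p a) w w' -> copies p (a :: w) (a :: w')
| CopiesInsert p b w w' : b \in p -> copies p w w' -> copies p w (b :: w').

Lemma copies_weaken p p' w w' : {subset p <= p'} -> copies p w w' -> copies p' w w'.
Proof.
move=> pp' cp; elim: cp p' pp' => {p w w'} [p|p a w w' _ IH|p b w w' bp _ IH] p' pp'.
- exact: CopiesNil.
- apply/CopiesKeep/IH => x; rewrite !mem_rcons !inE => /orP[->//|/pp'->].
  by rewrite orbT.
- by apply: CopiesInsert; [apply: pp' | apply: IH].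
Qed.

Lemma copies_cat p u u' w w' :
  all (mem p) u' -> subseq u u' -> copies p w w' -> copies p (u ++ w) (u' ++ w').
Proof.
move=> + + cw; elim: u' u => [|b u' IH] u /=; first by move=> _ /eqP->.
case/andP => bp u'p; case: u => [|a u] /=.
  by move=> _; apply: CopiesInsert => //; apply: (IH [::]) => //; apply: sub0seq.
case: eqP => [->|_] uu'; last by apply: CopiesInsert => //; apply: (IH (a :: u)).
apply/CopiesKeep/(copies_weaken _ (IH _ u'p uu')) => x xp.
by rewrite mem_rcons inE xp orbT.
Qed.

(** Cut at the first letter that is not in [p]: the prefixes use letters of [p] only, where
    every insertion is allowed and Higman's lemma applies, and for the suffixes one more
    letter has been read. *)
Lemma wqo_copies p : wqo_on setT (copies p).
Proof.
have [m] := ubnP #|[predC p]|; elim: m p => // m IHm p; rewrite ltnS => pm.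
have noq u : ~~ has [predC p] u -> all (mem p) u.
  by rewrite -all_predC; apply: sub_all => x /=; rewrite negbK.
apply: (@wqo_split [predC p] setT [set w | all (mem p) w] _
  (fun=> setT) (fun a => copies (rcons p a))).
- have := @higman [set x in p]; congr wqo_on; apply/funext => w /=.
  by congr is_true; apply: eq_all => x; rewrite !inE.
- move=> a /= ap; apply: IHm; apply: leq_trans pm.
  apply: proper_card; apply/properP; split.
    apply/fintype.subsetP => x; rewrite !inE mem_rcons inE; apply: contra => ->.
    by rewrite orbT.
  by exists a; rewrite !inE // mem_rcons mem_head.
- by move=> u _ /noq.
- by move=> u a v _ /noq.
- move=> u u' _ u'p uu'; rewrite -[u]cats0 -[u']cats0.
  by apply: copies_cat => //; apply: CopiesNil.
- move=> u u' a v v' _ u'p _ uu' vv'; apply: copies_cat => //; exact: CopiesKeep.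
Qed.

(** The word read as a numeral in base [#|A|]: on words of equal length, comparing values is
    the lexicographic order. *)
Fixpoint value w : nat :=
  if w is a :: u then enum_rank a * #|A| ^ size u + value u else 0.

Lemma value_bound w : value w < #|A| ^ size w.
Proof.
elim: w => //= a u IH; rewrite expnS.
apply: (@leq_trans ((enum_rank a).+1 * #|A| ^ size u)); first by rewrite mulSnr ltn_add2l.
by rewrite leq_mul2r ltn_ord orbT.
Qed.

Lemma value_inj u v : size u = size v -> value u = value v -> u = v.
Proof.
elim: u v => [|a u IH] [|b v] //= [suv]; rewrite -suv => e.
have Bu := value_bound u; have Bv := value_bound v; rewrite -suv in Bv.
have X0 := leq_ltn_trans (leq0n _) Bu.
congr cons; last first.
  apply: IH => //; have := congr1 (modn^~ (#|A| ^ size u)) e.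
  by rewrite /= !modnMDl !modn_small.
have := congr1 (divn^~ (#|A| ^ size u)) e.
by rewrite /= !divnMDl // !divn_small // !addn0 => /ord_inj/enum_rank_inj.
Qed.

Lemma value_cons a b u v : size u = size v ->
  (value (a :: u) < value (b :: v)) =
  (enum_rank a < enum_rank b) || (a == b) && (value u < value v).
Proof.
move=> suv /=; have Bu := value_bound u; have Bv := value_bound v.
rewrite suv in Bu *; have [->|ab] := eqVneq a b; first by rewrite ltnn ltn_add2l.
rewrite orbF; have [lt_ab|lt_ba|/ord_inj/enum_rank_inj e] := ltngtP (enum_rank a) (enum_rank b);
  last by rewrite e eqxx in ab.
- apply: (@leq_trans ((enum_rank a).+1 * #|A| ^ size v)); first by rewrite mulSnr ltn_add2l.
  by apply: leq_trans (leq_addr _ _); rewrite leq_mul2r lt_ab orbT.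
- apply/negbTE; rewrite -leqNgt.
  apply: (@leq_trans ((enum_rank b).+1 * #|A| ^ size v)); first by rewrite mulSnr leq_add2l ltnW.
  by apply: leq_trans (leq_addr _ _); rewrite leq_mul2r lt_ba orbT.
Qed.

(** The list [gs] is the map of positions behind [copies].  It is strictly monotone for the
    lexicographic order because a letter of [w] is used only after its first occurrence, so
    the first difference between [w1] and [w] is met at that occurrence.  Positions count
    from the start of the prefix [p], which is shared by both words. *)
Lemma copies_positions x0 p w w' : copies p w w' -> exists gs : seq nat,
  [/\ size gs = size w', all (fun i => i < size (p ++ w)) gs,
      [seq nth x0 (p ++ w) i | i <- gs] = w'
    & forall w1, size w1 = size w -> value w1 < value w ->
        value [seq nth x0 (p ++ w1) i | i <- gs] < value w'].
Proof.
elim=> {p w w'} [p|p a w w' _ [gs [sgs bgs egs lgs]]|p b w w' bp _ [gs [sgs bgs egs lgs]]].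
- by exists [::].
- exists (size p :: gs); split => /=.
  + by rewrite sgs.
  + by rewrite -cat_rcons bgs andbT size_cat size_rcons; lia.
  + by rewrite nth_cat ltnn subnn /= -cat_rcons egs.
  + case=> [|b w1] //= [sw1]; rewrite -!/(value (_ :: _)) value_cons // => lt1.
    rewrite value_cons ?size_map // nth_cat ltnn subnn /=.
    by case/orP: lt1 => [->//|/andP[/eqP-> /(lgs _ sw1)]]; rewrite -cat_rcons eqxx orbC => ->.
- exists (index b p :: gs); have ip : index b p < size p by rewrite index_mem.
  split => /=.
  + by rewrite sgs.
  + by rewrite bgs andbT size_cat; lia.
  + by rewrite nth_cat ip nth_index // egs.
  + move=> w1 sw1 /(lgs _ sw1) lt1.
    rewrite -!/(value (_ :: _)) value_cons ?size_map //.
    by rewrite nth_cat ip nth_index // eqxx lt1 orbT.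
Qed.

End Words.

Local Open Scope ring_scope.

(** * Chains of spaces of functions on words *)

Section Pivots.
Variables (K : fieldType) (X : finType) (rk : X -> nat).
Implicit Types (S : set (X -> K)) (f g : X -> K).

Definition subspace S : Prop :=
  S (fun=> 0) /\ forall c f g, S f -> S g -> S (fun x => f x - c * g x).

Definition pivot S (x : X) : Prop :=
  exists2 f, S f & f x != 0 /\ forall y, (rk y < rk x)%N -> f y = 0.

(** Gaussian elimination: a function of [S] whose first non-zero value is at [x] can be
    corrected by a function of [S'] with the same pivot so as to vanish up to [x]; repeat
    with larger pivots. *)
Lemma sub_of_pivots S S' :
    injective rk -> subspace S -> subspace S' -> (forall f, S' f -> S f) ->
    (forall x, pivot S x -> pivot S' x) ->
  forall f, S f -> S' f.
Proof.
move=> rk_inj [_ SB] [S'0 S'B] sub piv.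
(* [d] bounds the distance from the support of [f] to the end of the order. *)
pose M := (\max_x rk x).+1.
have rkM x : (rk x < M)%N by rewrite ltnS leq_bigmax.
suff H d f : S f -> (forall x, f x != 0 -> (M <= rk x + d)%N) -> S' f.
  by move=> f Sf; apply: (H M) => // x _; apply: leq_addl.
elim: d f => [|d IH] f Sf fd.
  have -> : f = fun=> 0; last by [].
  apply/funext => x; apply/eqP; apply: contraT => /fd.
  by rewrite addn0 leqNgt rkM.
have [[x [fx0 xd]]|nox] := pselect (exists x, f x != 0 /\ (rk x + d < M)%N);
    last first.
  apply: IH => // x fx0; rewrite leqNgt; apply/negP => xd.
  by apply: nox; exists x.
have rkx : (rk x + d.+1 = M)%N by apply/eqP; rewrite eqn_leq fd // addnS xd.
have flow y : (rk y < rk x)%N -> f y = 0.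
  move=> yx; apply/eqP; apply: contraT => /fd.
  by rewrite -rkx leq_add2r leqNgt yx.
have [|g S'g [gx0 glow]] := piv x; first by exists f.
pose h y := f y - f x / g x * g y.
have S'h : S' h.
  apply: IH => [|y hy0]; first exact/SB/sub.
  rewrite -rkx addnS -addSn leq_add2r ltn_neqAle leqNgt.
  apply/andP; split; apply: contraNN hy0; rewrite /h.
    by move=> /eqP/rk_inj <-; rewrite divfK // subrr.
  by move=> yx; rewrite (flow y) // (glow y) // mulr0 subrr.
have -> : f = fun y => h y - (- (f x / g x)) * g y; last exact: S'B.
by apply/funext => y; rewrite /h mulNr opprK subrK.
Qed.

End Pivots.

Section WordFunctions.
Variables (K : fieldType) (A : finType).

(** Pull back along the map of positions [g] with w' = w o g: words smaller than [w] are sent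
    to words smaller than [w'], where the given function vanishes. *)
Lemma pivot_copies (S : forall r, set (r.-tuple A -> K)) (w w' : seq A) :
    (forall r s (g : 'I_r -> 'I_s) (f : r.-tuple A -> K), S r f ->
       S s (fun u : s.-tuple A => f [tuple tnth u (g i) | i < r])) ->
    copies [::] w w' ->
    pivot (fun u : (size w').-tuple A => value u) (S (size w')) (in_tuple w') ->
  pivot (fun u : (size w).-tuple A => value u) (S (size w)) (in_tuple w).
Proof.
move=> Smap ww'.
have [->|[x0 _]] : w' = w \/ exists x0 : A, True.
- by case: w ww' => [|x0 w] ww'; [left; inversion ww' | right; exists x0].
- by [].
move=> [f Sf [fw' flow]].
have [gs [/= sgs bgs egs lgs]] := copies_positions x0 ww'.
have gP (i : 'I_(size w')) : (nth 0 gs i < size w)%N.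
  by apply: (all_nthP 0%N bgs); rewrite sgs.
pose g i := Ordinal (gP i).
have gE (u : (size w).-tuple A) :
    [tuple tnth u (g i) | i < size w'] = [seq nth x0 u i | i <- gs] :> seq A.
  apply: (@eq_from_nth _ x0); first by rewrite size_tuple size_map.
  move=> i; rewrite size_tuple => iw.
  rewrite (nth_map 0%N) ?sgs // -[i]/(nat_of_ord (Ordinal iw)) -tnth_nth tnth_mktuple.
  by rewrite (tnth_nth x0).
exists (fun u : (size w).-tuple A => f [tuple tnth u (g i) | i < size w']).
  exact: Smap.
split=> [|u uw]; last by apply: flow; rewrite /= gE lgs ?size_tuple.
suff -> : [tuple tnth (in_tuple w) (g i) | i < size w'] = in_tuple w' by [].
by apply: val_inj; rewrite /= gE.
Qed.

(** If the pivots never stabilized, choose indices N_0 < N_1 < ... and words w_i that are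
    pivots at stage N_i but not at stage N_(i+1).  For i < j with w_i below w_j, the word
    w_j is a pivot at stage N_j, hence at stage N_(i+1), and so is w_i: contradiction. *)
Theorem word_functions_artinian (S : nat -> forall r, set (r.-tuple A -> K)) :
    (forall k r, subspace (S k r)) ->
    (forall k r f, S k.+1 r f -> S k r f) ->
    (forall k r s (g : 'I_r -> 'I_s) (f : r.-tuple A -> K), S k r f ->
       S k s (fun u : s.-tuple A => f [tuple tnth u (g i) | i < r])) ->
  exists N, forall k, (N <= k)%N -> forall r f, S N r f -> S k r f.
Proof.
move=> Ssub Sdec Smap.
have Sdecs k N r f : (N <= k)%N -> S k r f -> S N r f.
  by move/subnK => <-; elim: (k - N)%N => // d IH /Sdec.
pose P k (w : seq A) :=
  pivot (fun u : (size w).-tuple A => value u) (S k (size w)) (in_tuple w).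
have Pdec k N w : (N <= k)%N -> P k w -> P N w.
  by move=> Nk [f Sf fw]; exists f => //; apply: Sdecs Sf.
suff [N NP] : exists N, forall k, (N <= k)%N -> forall w, P N w -> P k w.
  exists N => k Nk r; apply: (@sub_of_pivots _ _ (fun u : r.-tuple A => value u)).
  - by move=> u v uv; apply/val_inj/value_inj => //; rewrite !size_tuple.
  - by [].
  - by [].
  - by move=> f; apply: Sdecs.
  - move=> [u szu]; have szE := eqP szu; subst r.
    by have -> : Tuple szu = in_tuple u; [apply: val_inj | apply: NP].
apply: contrapT => /forallNP nostop.
have /choice[next nextP] N : exists kw : nat * seq A,
    [/\ (N <= kw.1)%N, P N kw.2 & ~ P kw.1 kw.2].
  apply: contrapT => /forallNP stop; apply: (nostop N) => k Nk w PN.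
  by apply: contrapT => nP; apply: (stop (k, w)).
pose idx i := iter i (fun N => (next N).1) 0%N.
have idx_le i j : (i <= j)%N -> (idx i <= idx j)%N.
  apply: (homo_leq (f := idx) (r := leq)) => [//|y x z|k]; first exact: leq_trans.
  by have [] := nextP (idx k).
have [h hmono hcop] := wqo_copies [::] (f := fun i => (next (idx i)).2) (fun=> I).
have [_ _ nP] := nextP (idx (h 0%N)); apply: nP.
apply: (@pivot_copies (S _)); [by move=> *; apply: Smap | exact: (hcop 0%N 1%N) |].
have [_ P1 _] := nextP (idx (h 1%N)).
by apply: Pdec P1; apply: (idx_le (h 0%N).+1); apply: hmono.
Qed.

End WordFunctions.

(** * Monomorphisms and subobjects of functors *)

Lemma freeg_linear_ext (R : nzRingType) (X : choiceType) (N : lmodType R)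
    (f g : {linear {freeg X / R} -> N}) :
  (forall x, f (fgen R x) = g (fgen R x)) -> f =1 g.
Proof.
move=> fg x; rewrite [x]freeg_gen_sum !linear_sum.
by apply: eq_bigr => z _; rewrite !linearZ /= fg.
Qed.

Section Representable.
Variable V : vectType 'F_2.

(** The functor of linear combinations of linear maps out of [V].  By Yoneda its morphisms
    to [F] are the elements of [F V], so it tests injectivity at [V]. *)
Definition repr_obj (W : vectType 'F_2) : lmodType 'F_2 :=
  {freeg 'Hom(V, W) / 'F_2}.

Definition repr_map (W W' : vectType 'F_2) (f : 'Hom(W, W')) :
    {linear repr_obj W -> repr_obj W'} :=
  fglift (fun g : 'Hom(V, W) => fgen 'F_2 (f \o g)%VF).

Lemma repr_map_id (W : vectType 'F_2) : repr_map (\1%VF : 'Hom(W, W)) =1 id.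
Proof.
apply: (freeg_linear_ext (g := idfun)) => g.
by rewrite /= fglift_gen comp_lfun1l.
Qed.

Lemma repr_map_comp (U W W' : vectType 'F_2) (g : 'Hom(W, W')) (f : 'Hom(U, W)) :
  repr_map (g \o f)%VF =1 repr_map g \o repr_map f.
Proof.
apply: (freeg_linear_ext (g := repr_map g \o repr_map f)) => h.
by rewrite /repr_map /= !fglift_gen comp_lfunA.
Qed.

Definition representable : vfunctor := VFunctor repr_map_id repr_map_comp.

Definition yoneda_comp (F : vfunctor) (x : F V) (W : vectType 'F_2) :
    {linear representable W -> F W} :=
  fglift (fun g : 'Hom(V, W) => fmap F g x).

Lemma yoneda_natural (F : vfunctor) (x : F V) (W W' : vectType 'F_2)
    (f : 'Hom(W, W')) (y : representable W) :
  yoneda_comp x W' (fmap representable f y) = fmap F f (yoneda_comp x W y).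
Proof.
move: y; apply: (freeg_linear_ext (f := yoneda_comp x W' \o repr_map f)
  (g := fmap F f \o yoneda_comp x W)) => g.
by rewrite /yoneda_comp /repr_map /= !fglift_gen fmap_comp.
Qed.

Definition yoneda (F : vfunctor) (x : F V) : nattrans representable F :=
  NatTrans (yoneda_natural x).

End Representable.

Lemma mono_injective (F G : vfunctor) (m : nattrans F G) :
  mono m -> forall V, injective (m V).
Proof.
move=> m_mono V x y mxy.
have myx : forall W z, m W (yoneda x W z) = m W (yoneda y W z).
  move=> W; apply: (freeg_linear_ext (f := m W \o yoneda_comp x W)
                                     (g := m W \o yoneda_comp y W)) => g.
  by rewrite /= !fglift_gen !natural mxy.
have := m_mono _ _ _ myx V (fgen 'F_2 \1%VF).
by rewrite /= !fglift_gen !fmap_id.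
Qed.

Section Factor.
Variables (R : nzRingType) (U V W : lmodType R).
Variables (f : {linear U -> W}) (g : {linear V -> W}).

(** The proofs are arguments so that linearity can be attached to the function. *)
Definition factor of injective g & (forall x, exists y, g y = f x) : U -> V :=
  fun x => xget 0 [set y | g y = f x].

Hypotheses (g_inj : injective g) (fg : forall x, exists y, g y = f x).

Lemma factorE x : g (factor g_inj fg x) = f x.
Proof. exact: (xgetPex 0 (fg x)). Qed.

Lemma factor_linear : linear (factor g_inj fg).
Proof. by move=> a x y; apply: g_inj; rewrite linearP !factorE linearP. Qed.

HB.instance Definition _ :=
  GRing.isLinear.Build R U V *:%R (factor g_inj fg) factor_linear.

End Factor.

Lemma sub_le_image (F : vfunctor) (S T : subobject F) :
    (forall V x, exists y, sub_incl T V y = sub_incl S V x) ->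
  sub_le S T.
Proof.
move=> ST; have T_inj := @mono_injective _ _ _ (@sub_mono _ T).
pose h V : {linear sub_dom S V -> sub_dom T V} := factor (@T_inj V) (ST V).
have hE V x : sub_incl T V (h V x) = sub_incl S V x by apply: factorE.
have h_nat (V W : vectType 'F_2) (f : 'Hom(V, W)) x :
    h W (fmap (sub_dom S) f x) = fmap (sub_dom T) f (h V x).
  by apply: (@T_inj W); rewrite natural !hE natural.
by exists (NatTrans h_nat).
Qed.

(** Coordinates in a basis make [V] a retract of a space of row vectors, and naturality
    transports preimages along the retraction. *)
Lemma sub_le_image_rV (F : vfunctor) (S T : subobject F) :
    (forall r (x : sub_dom S 'rV['F_2]_r), exists y,
       sub_incl T 'rV['F_2]_r y = sub_incl S 'rV['F_2]_r x) ->
  sub_le S T.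
Proof.
move=> ST; apply: sub_le_image => V x.
pose e := vbasis {:V}.
pose i : 'Hom(V, 'rV['F_2]_(\dim {:V})) := linfun (rVof e).
pose j : 'Hom('rV['F_2]_(\dim {:V}), V) := linfun (vecof e).
have ji : (j \o i)%VF = \1%VF.
  by apply/lfunP => v; rewrite comp_lfunE id_lfunE !lfunE /= rVofK // vbasisP.
have [y yx] := ST _ (fmap (sub_dom S) i x).
exists (fmap (sub_dom T) j y); rewrite natural yx natural.
by rewrite -[LHS]/((fmap F j \o fmap F i) _) -fmap_comp ji fmap_id.
Qed.

(** * Tensor products, and expansion of multilinear maps *)

Section Generation.
Variable R : comNzRingType.

Lemma freeg_quot_ind (X : choiceType) (A : set {freeg X / R}) (P : lquot A -> Prop) :
    P 0 -> (forall x y, P x -> P y -> P (x + y)) ->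
    (forall a x, P (a *: qgen A x)) ->
  forall x, P x.
Proof.
move=> P0 PD Pgen x; have [y ->] := lquot_proj_surj x.
rewrite [y]freeg_gen_sum linear_sum; apply: big_ind => // z _.
by rewrite linearZ; apply: Pgen.
Qed.

Variables U V : lmodType R.

(** A name for the flipped [pure], to carry its linear structure. *)
Definition pure_left (v : V) : U -> tens U V := fun u => pure u v.

HB.instance Definition _ (v : V) :=
  GRing.isLinear.Build R U (tens U V) *:%R (pure_left v) (@pure_linl R U V v).
HB.instance Definition _ (u : U) :=
  GRing.isLinear.Build R V (tens U V) *:%R (@pure R U V u) (@pure_linr R U V u).

Lemma tens_ind (P : tens U V -> Prop) :
    P 0 -> (forall x y, P x -> P y -> P (x + y)) ->
    (forall u v, P (pure u v)) ->
  forall x, P x.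
Proof.
move=> P0 PD Ppure; apply: freeg_quot_ind => // a [u v].
by rewrite -[_ *: _]/(a *: pure_left v u) -linearZ; apply: Ppure.
Qed.

Lemma pure_sum (I J : Type) (r : seq I) (t : seq J) (a : I -> R) (b : J -> R)
    (u : I -> U) (v : J -> V) :
  pure (\sum_(i <- r) a i *: u i) (\sum_(j <- t) b j *: v j) =
  \sum_(i <- r) \sum_(j <- t) (a i * b j) *: pure (u i) (v j).
Proof.
rewrite -[LHS]/(pure_left _ _) linear_sum; apply: eq_bigr => i _.
rewrite linearZ /= /pure_left linear_sum scaler_sumr; apply: eq_bigr => j _.
by rewrite linearZ scalerA.
Qed.

End Generation.

Section MultilinearExpansion.
Variables (R : comNzRingType) (n : nat) (V N : lmodType R) (J : finType).
Variables (e : J -> V) (coord : V -> J -> R).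
Hypothesis coordK : forall v, v = \sum_j coord v j *: e j.

Lemma linear_combination (f : V -> N) : linear f ->
  forall v, f v = \sum_j coord v j *: f (e j).
Proof.
move=> lf v; rewrite {1}[v]coordK.
elim/big_rec2: _ => [|j y x _ <-]; last exact: lf.
by have := lf (-1) 0 0; rewrite !scaleN1r !addNr.
Qed.

(** Each argument is expanded in the family [e] in turn.  The result is a finite sum of
    products of linear forms, the form in argument [i] being given by its coefficients
    [x.1 i]; since it is existential, no index set has to be named. *)
Lemma multilinear_expansion (m : {ffun 'I_n -> V} -> N) : multilinear m ->
  exists L : seq ({ffun 'I_n -> {ffun J -> R}} * N), forall v,
    m v = \sum_(x <- L) (\prod_i \sum_j coord (v i) j * x.1 i j) *: x.2.
Proof.
move=> mlin.
(* In [mix s u v] the arguments with index in [s] have been expanded. *)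
pose mix (s : seq 'I_n) (u v : {ffun 'I_n -> V}) :=
  [ffun i => if i \in s then u i else v i].
suff /(_ _ (enum_uniq 'I_n))[L HL] (s : seq 'I_n) : uniq s ->
    exists L : seq ({ffun 'I_n -> {ffun J -> R}} * {ffun 'I_n -> V}), forall v,
    m v = \sum_(x <- L) (\prod_(i <- s) \sum_j coord (v i) j * x.1 i j)
                         *: m (mix s x.2 v).
  exists [seq (x.1, m x.2) | x <- L] => v; rewrite HL big_map.
  apply: eq_bigr => x _ /=; rewrite big_enum /=; congr (_ *: m _).
  by apply/ffunP => i; rewrite ffunE mem_enum.
(* For empty [s] the initial values are irrelevant: they are used on [s] only. *)
elim: s => [_|a s IH /andP[a_s /IH[L HL]]].
  exists [:: ([ffun=> 0], [ffun=> 0])] => v.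
  rewrite big_seq1 big_nil scale1r; congr m.
  by apply/ffunP => i; rewrite ffunE in_nil.
exists [seq (upd x.1 a [ffun k => (k == j)%:R], upd x.2 a (e j))
       | x <- L, j <- enum J] => v.
rewrite HL big_allpairs_dep /=; apply: eq_bigr => x _; rewrite big_enum /=.
have -> : mix s x.2 v = upd (mix s x.2 v) a (v a).
  by apply/ffunP => i; rewrite !ffunE; case: eqP => // ->; rewrite (negbTE a_s).
rewrite (linear_combination (mlin _ a)) scaler_sumr; apply: eq_bigr => j _.
rewrite scalerA big_cons mulrC; congr (_ * _ *: m _).
- rewrite (bigD1 j) //= !ffunE eqxx !ffunE eqxx mulr1 big1 ?addr0 // => k kj.
  by rewrite ffunE (negbTE kj) mulr0.
- rewrite !big_seq; apply: eq_bigr => i i_s; apply: eq_bigr => k _.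
  by rewrite [upd _ _ _ i]ffunE; case: eqP i_s a_s => // -> ->.
- apply/ffunP => i; rewrite !ffunE inE; by case: eqP.
Qed.

End MultilinearExpansion.

(** * Linear forms as words *)

Section CovectorWords.

Definition dot r (c : 'I_r -> 'F_2) (v : 'rV['F_2]_r) : ('F_2)^o :=
  \sum_i v 0 i * c i.

Lemma dot_linear r (c : 'I_r -> 'F_2) : linear (dot c).
Proof.
move=> a v w; rewrite /dot scaler_sumr -big_split.
by apply: eq_bigr => i _; rewrite !mxE mulrDl -mulrA.
Qed.

HB.instance Definition _ r (c : 'I_r -> 'F_2) :=
  GRing.isLinear.Build 'F_2 'rV['F_2]_r ('F_2)^o *:%R (dot c) (dot_linear c).

Definition covector r (c : 'I_r -> 'F_2) : dual 'rV['F_2]_r := linfun (dot c).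

Lemma covectorE r (c : 'I_r -> 'F_2) v : covector c v = \sum_i v 0 i * c i.
Proof. exact: lfunE. Qed.

Lemma covector_ext r (c c' : 'I_r -> 'F_2) : c =1 c' -> covector c = covector c'.
Proof. by move/funext->. Qed.

Lemma covector_delta r (c : 'I_r -> 'F_2) i : covector c (delta_mx 0 i) = c i.
Proof.
rewrite covectorE (bigD1 i) //= mxE !eqxx mul1r big1 ?addr0 // => k ki.
by rewrite mxE (negbTE ki) mul0r.
Qed.

Lemma covector_inj r (c c' : {ffun 'I_r -> 'F_2}) : covector c = covector c' -> c = c'.
Proof.
by move=> cc'; apply/ffunP => i; rewrite -!covector_delta cc'.
Qed.

Lemma covector_surj r (l : dual 'rV['F_2]_r) :
  exists c : {ffun 'I_r -> 'F_2}, l = covector c.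
Proof.
exists [ffun i => l (delta_mx 0 i)]; apply/lfunP => v.
rewrite covectorE {1}[v]row_sum_delta linear_sum; apply: eq_bigr => i _.
by rewrite linearZ ffunE.
Qed.

Definition shift r s (g : 'I_r -> 'I_s) : 'Hom('rV['F_2]_r, 'rV['F_2]_s) :=
  linfun (mulmxr (\matrix_i delta_mx 0 (g i))).

Lemma covector_shift r s (g : 'I_r -> 'I_s) (c : 'I_s -> 'F_2) :
  (covector c \o shift g)%VF = covector (fun i => c (g i)).
Proof.
apply/lfunP => v; rewrite comp_lfunE [shift g v]lfunE /= mulmx_sum_row linear_sum covectorE.
by apply: eq_bigr => i _; rewrite linearZ /= rowK covector_delta.
Qed.

Lemma dual_fun_expansion r (phi : dual_fun 'rV['F_2]_r) :
  phi = \sum_(c : {ffun 'I_r -> 'F_2})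
          phi (covector c) *: ((fun l => (l == covector c)%:R) : dual_fun 'rV['F_2]_r).
Proof.
apply/funext => l; have [c ->] := covector_surj l.
rewrite fct_sumE (bigD1 c) //= big1 ?addr0 => [|c' c'c].
  by rewrite /GRing.scale /= eqxx /GRing.scale /= mulr1.
rewrite /GRing.scale /= /GRing.scale /=.
case: eqP => [/covector_inj cc'|_]; last by rewrite mulr0.
by rewrite cc' eqxx in c'c.
Qed.

End CovectorWords.

(** * Subobjects as spaces of functions on words *)

Section Generators.
Variable n : nat.

Local Notation T := (tensF (tensF Ifun Ifun) (extF n)).
Local Notation letter := ('F_2 * 'F_2 * {ffun 'I_n -> 'F_2})%type.

Definition generator (V : vectType 'F_2) : Type :=
  (dual_fun V * dual_fun V * {ffun 'I_n -> V})%type.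

Definition gen_elt (V : vectType 'F_2) (p : generator V) : T V :=
  pure (pure p.1.1 p.1.2) (wedge p.2).

Definition gen_map (V W : vectType 'F_2) (f : 'Hom(V, W)) (p : generator V) :
    generator W :=
  (dual_fun_map f p.1.1, dual_fun_map f p.1.2, [ffun i => f (p.2 i)]).

Definition gen_scale (V : vectType 'F_2) (c : 'F_2) (p : generator V) : generator V :=
  (c *: p.1.1, p.1.2, p.2).

Lemma gen_elt_map (V W : vectType 'F_2) (f : 'Hom(V, W)) (p : generator V) :
  fmap T f (gen_elt p) = gen_elt (gen_map f p).
Proof.
rewrite -[fmap T f]/(tens_map (tens_map (fmap Ifun f) (fmap Ifun f)) (ext_map n f)).
by rewrite /gen_elt !tens_mapE ext_mapE.
Qed.

Lemma gen_elt_scale (V : vectType 'F_2) (c : 'F_2) (p : generator V) :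
  gen_elt (gen_scale c p) = c *: gen_elt p.
Proof.
rewrite /gen_elt /gen_scale /= -[pure (c *: _) _]/(pure_left p.1.2 (c *: p.1.1)).
by rewrite linearZ /= -[pure (c *: _) _]/(pure_left (wedge p.2) (c *: _)) linearZ.
Qed.

Lemma gen_elt_span (V : vectType 'F_2) (x : T V) :
  exists s : seq (generator V), x = \sum_(p <- s) gen_elt p.
Proof.
pose P (x : T V) := exists s : seq (generator V), x = \sum_(p <- s) gen_elt p.
have P0 : P 0 by exists [::]; rewrite big_nil.
have PD x' y : P x' -> P y -> P (x' + y).
  by move=> [s ->] [t ->]; exists (s ++ t); rewrite big_cat.
apply: (tens_ind (P := P)) => // u w; move: w.
pose Q (u : tens (dual_fun V) (dual_fun V)) := forall w : ext n V, P (pure_left w u).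
move: u; apply: (tens_ind (P := Q)) => [w|x' y Px Py w|phi psi w].
- by rewrite linear0.
- by rewrite linearD; apply: PD; [apply: Px | apply: Py].
pose Q' (w : ext n V) := P (pure (pure phi psi) w).
move: w; apply: (freeg_quot_ind (P := Q')) => [|x' y Px Py|a v]; rewrite /Q'.
- by rewrite linear0.
- by rewrite linearD; apply: PD.
exists [:: gen_scale a (phi, psi, v)].
by rewrite big_seq1 gen_elt_scale linearZ.
Qed.

Definition word_fun r (p : generator 'rV['F_2]_r) (u : r.-tuple letter) : 'F_2 :=
  p.1.1 (covector (fun t => (tnth u t).1.1)) *
  p.1.2 (covector (fun t => (tnth u t).1.2)) *
  \prod_i covector (fun t => (tnth u t).2 i) (p.2 i).

Lemma word_fun_scale r c (p : generator 'rV['F_2]_r) u :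
  word_fun (gen_scale c p) u = c * word_fun p u.
Proof. by rewrite /word_fun -!mulrA. Qed.

Lemma word_fun_shift r s (g : 'I_r -> 'I_s) (p : generator 'rV['F_2]_r)
    (u : s.-tuple letter) :
  word_fun (gen_map (shift g) p) u = word_fun p [tuple tnth u (g t) | t < r].
Proof.
rewrite /word_fun /= /dual_fun_map !covector_shift; congr (_ * _ * _).
- by congr (p.1.1 _); apply: covector_ext => t; rewrite tnth_mktuple.
- by congr (p.1.2 _); apply: covector_ext => t; rewrite tnth_mktuple.
- apply: eq_bigr => i _; rewrite ffunE -comp_lfunE covector_shift.
  by rewrite !covectorE; apply: eq_bigr => t _; rewrite tnth_mktuple.
Qed.

(** [phi] and [psi] are combinations of indicator functions of linear forms, with their values
    as coefficients, and the wedge is expanded multilinearly.  Each coefficient so obtained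
    is the value of the function of [p] at a tuple of linear forms, that is, at a word. *)
Lemma gen_elt_expansion r : exists X : seq (r.-tuple letter * T 'rV['F_2]_r),
  forall p, gen_elt p = \sum_(x <- X) word_fun p x.1 *: x.2.
Proof.
have coordK (v : 'rV['F_2]_r) : v = \sum_j v 0 j *: delta_mx 0 j.
  exact: row_sum_delta.
have [L HL] := multilinear_expansion coordK (@wedge_multilinear 'F_2 n 'rV['F_2]_r).
pose delta (c : {ffun 'I_r -> 'F_2}) : dual_fun 'rV['F_2]_r :=
  fun l => (l == covector c)%:R.
pose word (c : {ffun 'I_r -> 'F_2} * {ffun 'I_r -> 'F_2})
    (d : {ffun 'I_n -> {ffun 'I_r -> 'F_2}}) :=
  [tuple (c.1 t, c.2 t, [ffun i => d i t]) | t < r].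
exists [seq (word c y.1, pure (pure (delta c.1) (delta c.2)) y.2)
       | c <- enum {: {ffun 'I_r -> 'F_2} * {ffun 'I_r -> 'F_2}}, y <- L].
move=> [[phi psi] v]; rewrite big_allpairs_dep big_enum /gen_elt.
have pure2 : pure phi psi = \sum_(c : {ffun 'I_r -> 'F_2} * {ffun 'I_r -> 'F_2})
    (phi (covector c.1) * psi (covector c.2)) *: pure (delta c.1) (delta c.2).
  rewrite {1}[phi]dual_fun_expansion {1}[psi]dual_fun_expansion.
  by apply: etrans (pure_sum _ _ _ _ _ _) _; rewrite pair_bigA.
apply: etrans (congr2 (@pure _ _ _) pure2 (HL v)) _.
apply: etrans (pure_sum _ _ _ _ _ _) _.
apply: eq_bigr => c _; apply: eq_bigr => y _; congr (_ *: _).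
rewrite /word_fun /=; congr (phi _ * psi _ * _).
- by apply: covector_ext => t; rewrite tnth_mktuple.
- by apply: covector_ext => t; rewrite tnth_mktuple.
- apply: eq_bigr => i _; rewrite covectorE; apply: eq_bigr => t _.
  by rewrite tnth_mktuple ffunE.
Qed.

(** The expansion of an elementary element only involves values of its function. *)
Lemma word_fun_determines r (s t : seq (generator 'rV['F_2]_r)) :
    (forall u, \sum_(p <- s) word_fun p u = \sum_(p <- t) word_fun p u) ->
  \sum_(p <- s) gen_elt p = \sum_(p <- t) gen_elt p.
Proof.
have [X XE] := gen_elt_expansion r => st.
have E (q : seq (generator 'rV['F_2]_r)) : \sum_(p <- q) gen_elt p =
    \sum_(x <- X) (\sum_(p <- q) word_fun p x.1) *: x.2.
  under eq_bigr do rewrite XE; rewrite exchange_big /=.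
  by apply: eq_bigr => x _; rewrite scaler_suml.
by rewrite !E; apply: eq_bigr => x _; rewrite st.
Qed.

(** The functions attached to expressions, as sums of elementary elements, of members of
    [S].  All expressions are allowed, which makes the exterior power accessible as a
    quotient of a tensor power, without a basis of it. *)
Definition lifts (S : subobject T) r : set (r.-tuple letter -> 'F_2) :=
  fun f => exists s y, f = (fun u => \sum_(p <- s) word_fun p u) /\
    sub_incl S 'rV['F_2]_r y = \sum_(p <- s) gen_elt p.

Lemma lifts_subspace S r : subspace (@lifts S r).
Proof.
split=> [|c f g [s [y [-> ys]]] [t [z [-> zt]]]].
  exists [::], 0; rewrite linear0 big_nil; split=> //.
  by apply/funext => u; rewrite big_nil.
exists (s ++ [seq gen_scale (- c) p | p <- t]), (y - c *: z); split.
  apply/funext => u; rewrite big_cat big_map -mulNr mulr_sumr; congr (_ + _).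
  by apply: eq_bigr => p _; rewrite word_fun_scale.
rewrite linearB linearZ ys zt big_cat big_map -scaleNr scaler_sumr; congr (_ + _).
by apply: eq_bigr => p _; rewrite gen_elt_scale.
Qed.

Lemma lifts_shift S r s (g : 'I_r -> 'I_s) (f : r.-tuple letter -> 'F_2) :
  lifts S f -> lifts S (fun u : s.-tuple letter => f [tuple tnth u (g t) | t < r]).
Proof.
move=> [q [y [-> yq]]].
exists [seq gen_map (shift g) p | p <- q], (fmap (sub_dom S) (shift g) y); split.
  apply/funext => u; rewrite big_map.
  by apply: eq_bigr => p _; rewrite word_fun_shift.
rewrite natural yq linear_sum big_map.
by apply: eq_bigr => p _; rewrite gen_elt_map.
Qed.

Lemma lifts_le S S' r (f : r.-tuple letter -> 'F_2) :
  sub_le S S' -> lifts S f -> lifts S' f.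
Proof.
move=> [h hE] [s [y [fE ys]]].
by exists s, (h 'rV['F_2]_r y); rewrite hE.
Qed.

(** Express a member of [S] by elementary elements.  Its function also comes from a member
    of [S'], and the two members agree since the function determines them. *)
Lemma sub_le_lifts S S' :
  (forall r (f : r.-tuple letter -> 'F_2), lifts S f -> lifts S' f) -> sub_le S S'.
Proof.
move=> SS'; apply: sub_le_image_rV => r x.
have [s xs] := gen_elt_span (sub_incl S 'rV['F_2]_r x).
have [|t [y [st yt]]] := SS' r (fun u => \sum_(p <- s) word_fun p u).
  by exists s, x.
exists y; rewrite yt xs; apply: word_fun_determines => u.
by rewrite -[LHS]/((fun u => \sum_(p <- t) word_fun p u) u) -st.
Qed.

End Generators.

Lemma sub_le_trans (F : vfunctor) (S T U : subobject F) :
  sub_le S T -> sub_le T U -> sub_le S U.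
Proof.
move=> [h hE] [k kE].
have kh_nat (V W : vectType 'F_2) (f : 'Hom(V, W)) (x : sub_dom S V) :
    (k W \o h W) (fmap (sub_dom S) f x) = fmap (sub_dom U) f ((k V \o h V) x).
  by rewrite /= !natural.
by exists (NatTrans kh_nat) => V x; rewrite /= kE hE.
Qed.

Lemma sub_le_refl (F : vfunctor) (S : subobject F) : sub_le S S.
Proof.
have id_nat (V W : vectType 'F_2) (f : 'Hom(V, W)) (x : sub_dom S V) :
  idfun (fmap (sub_dom S) f x) = fmap (sub_dom S) f (idfun x) by [].
by exists (NatTrans id_nat).
Qed.

Theorem mainTheorem1 (n : nat) : artinian (tensF (tensF Ifun Ifun) (extF n)).
Proof.
move=> S Sdec.
have [N NP] := word_functions_artinian
  (fun k r => lifts_subspace (S k) r)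
  (fun k r f => lifts_le (f := f) (Sdec k))
  (fun k r s g f => @lifts_shift n (S k) r s g f).
exists N => k Nk; split; last exact/sub_le_lifts/NP.
move: Nk => /subnK <-; elim: (k - N)%N => [|d IH]; first exact: sub_le_refl.
exact: sub_le_trans (Sdec _) IH.
Qed.
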